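(* Consider the convex problem $$\min_{x\in\mathcal X} f(x)\quad\text{s.t.}\quad h(x)=0,\ g(x)\le 0 \qquad (\mathrm P)$$ where $\mathcal X$ is a finite dimensional real Hilbert space, $f:\mathcal X\to(-\infty,+\infty]$ is a closed proper convex function, $h:\mathcal X\to\mathbb R^{m_1}$ is affine, and $g=(g_1,\dots,g_{m_2}):\mathcal X\to\mathbb R^{m_2}$ with each $g_i:\mathcal X\to(-\infty,\infty)$ convex and continuously differentiable. Let $\mathcal L$ be its Lagrangian function, let $X^*$ be the solution set of $(\mathrm P)$ and $P^*$ the solution set of its dual. Suppose that the solution set $X^*\times P^*$ of the KKT system of $(\mathrm P)$ is nonempty. Let $\sigma\in[0,1)$, let $\{c_k\}_{k\ge1}$ be a sequence of positive real numbers with $\inf_{k\ge1}c_k>0$, and suppose that the infinite sequences $\{x^k\},\{y^k\},\{w^k\},\{p^k\}=\{(\lambda^k,\mu^k)\}$ generated by the inexact augmented Lagrangian method described in the context (with parameters $\sigma$ and $\{c_k\}$) are well-defined. Suppose further that $(\partial\mathcal L)^{-1}$ is locally upper Lipschitz continuous at the origin, with constants $\kappa>0$ and $\epsilon>0$, i.e. $(\partial \mathcal L)^{-1}(0)\neq\emptyset$ and $$\operatorname{dist}\big(z,(\partial\mathcal L)^{-1}(0)\big)\le\kappa\|\beta\|\quad\text{for all }\beta\text{ with }\|\beta\|\le\epsilon\text{ and all }z\in(\partial\mathcal L)^{-1}(\beta).$$ Then the following statements hold. (a) For all sufficiently large $k$, $$\operatorname{dist}(x^k,X^* )\le\frac{\kappa(1+\sqrt\sigma)}{c_k}\,\|p^{k-1}-p^k\|,$$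 so that $\lim_{k\to\infty}\operatorname{dist}(x^k,X^* )=0$. (b) If, additionally, $\liminf_{k\to\infty}c_k>2\kappa(\sigma+\sqrt\sigma)$, then for all sufficiently large $k$, $$\operatorname{dist}(p^k,P^* )\le\rho_k\operatorname{dist}(p^{k-1},P^* ),\qquad \rho_k:=\frac{\kappa\sqrt{1+\sigma}}{\sqrt{c_k^2-2\kappa(\sigma+\sqrt\sigma)\,c_k+\kappa^2(1+\sigma)}},$$ and $\limsup_{k\to\infty}\rho_k<1$. That is, the local rate of convergence of the method is Q-linear, and the modulus $\rho_k$ of the convergence rate tends to zero if the sequence $\{c_k\}$ increases to infinity.
   Context: Norms and distances. $\langle\cdot,\cdot\rangle$ and $\|\cdot\|$ denote the inner product and induced norm of the space at hand; $\mathbb R^l$ carries the dot product and Euclidean norm; product spaces carry the product inner product (so $\|(y,u)\|^2=\|y\|^2+\|u\|^2$). For a nonempty closed convex set $C$, $\operatorname{dist}(z,C)=\min_{z'\in C}\|z-z'\|$. Maxima and minima of vectors, and vector inequalities, are componentwise. $\partial$ of a convex function is the usual convex subdifferential, and $\partial_x$ is the convex subdifferential with respect to $x$. Let $m=m_1+m_2$. Lagrangian and dual. For $x\in\mathcal X$, $\lambda\in\mathbb R^{m_1}$, $\mu\in\mathbb R^{m_2}$, $$\mathcal L(x;\lambda,\mu)=\begin{cases} f(x)+\langle\lambda,h(x)\rangle+\langle\mu,g(x)\rangle,&\mu\ge0,\\ -\infty,&\text{otherwise.}\end{cases}$$ The dual of $(\mathrm P)$ is $\max_{\lambda\in\mathbb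 R^{m_1},\,\mu\in\mathbb R^{m_2}} d(\lambda,\mu)$ with $d(\lambda,\mu):=\inf_{x\in\mathcal X}\mathcal L(x;\lambda,\mu)$. The set-valued mapping $\partial\mathcal L:\mathcal X\times\mathbb R^{m_1}\times\mathbb R^{m_2}\to\mathcal X\times\mathbb R^{m_1}\times\mathbb R^{m_2}$ is defined by: $(y;u,v)\in\partial\mathcal L(x,\lambda,\mu)$ if and only if $$\mathcal L(x';\lambda,\mu)\ge\mathcal L(x;\lambda,\mu)+\langle y,x'-x\rangle\quad\forall x'\in\mathcal X,$$ $$\mathcal L(x;\lambda',\mu')\le\mathcal L(x;\lambda,\mu)-\langle u,\lambda'-\lambda\rangle-\langle v,\mu'-\mu\rangle\quad\forall(\lambda',\mu')\in\mathbb R^{m_1}\times\mathbb R^{m_2}.$$ Its inverse is $(\partial\mathcal L)^{-1}(\beta)=\{z:\beta\in\partial\mathcal L(z)\}$. KKT system. $(x,\lambda,\mu)$ solves the KKT system of $(\mathrm P)$ if $$0\in\partial f(x)+\nabla h(x)\lambda+\nabla g(x)\mu,\quad h(x)=0,\quad g(x)\le0,\ \mu\ge0,\ \langle\mu,g(x)\rangle=0,$$ where $\nabla h(x)\lambda=\sum_i\lambda_i\nabla h_i(x)$ and $\nabla g(x)\mu=\sum_i\mu_i\nabla g_i(x)$. When the solution set of the KKT system is nonempty, it equals $X^*\times P^*=(\partial\mathcal L)^{-1}(0)$, where $X^*$ is the solution set of $(\mathrm P)$ and $P^*$ is the solution set of the dual. Augmented Lagrangian. For $c>0$, $$\mathcal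 L_c(x,\lambda,\mu)=f(x)+\langle\lambda,h(x)\rangle+\frac c2\|h(x)\|^2+\frac1{2c}\sum_{i=1}^{m_2}\Big(\big(\max\{0,\mu_i+cg_i(x)\}\big)^2-\mu_i^2\Big).$$ The method (inexact augmented Lagrangian method with relative error criterion). Given $\sigma\in[0,1)$ and positive $\{c_k\}$ with $\inf_{k\ge1}c_k>0$, choose $\lambda^0\in\mathbb R^{m_1}$, $\mu^0\in\mathbb R^{m_2}_+$ and $w^0\in\mathcal X$. For $k=1,2,\dots$: 1. find $x^k\in\mathcal X$ and $y^k\in\mathcal X$ such that $y^k\in\partial_x\mathcal L_{c_k}(x^k,\lambda^{k-1},\mu^{k-1})$ and $$\frac2{c_k}\big|\langle w^{k-1}-x^k,y^k\rangle\big|+\|y^k\|^2\le\sigma\left(\|h(x^k)\|^2+\Big\|\min\Big\{\frac1{c_k}\mu^{k-1},-g(x^k)\Big\}\Big\|^2\right);$$ 2. set $\lambda^k:=\lambda^{k-1}+c_kh(x^k)$, $\mu^k:=\max\{0,\mu^{k-1}+c_kg(x^k)\}$, and $w^k:=w^{k-1}-c_ky^k$. ''Well-defined'' means that such $x^k,y^k$ are found for every $k\ge1$, so that infinite sequences are given which satisfy, for every $k\ge1$, the inclusion $y^k\in\partial_x\mathcal L_{c_k}(x^k,\lambda^{k-1},\mu^{k-1})$, the inequality $\frac2{c_k}\big|\langle w^{k-1}-x^k,y^k\rangle\big|+\|y^k\|^2\le\sigma\big(\|h(x^k)\|^2+\big\|\min\{\frac1{c_k}\mu^{k-1},-g(x^k)\}\big\|^2\big)$,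 and the update formulas $\lambda^k=\lambda^{k-1}+c_kh(x^k)$, $\mu^k=\max\{0,\mu^{k-1}+c_kg(x^k)\}$, $w^k=w^{k-1}-c_ky^k$. Write $p^k:=(\lambda^k,\mu^k)\in\mathbb R^m$ for $k\ge0$. *)

(* Defs.v *)
From HB Require Import structures.
From mathcomp Require Import all_boot all_order all_algebra.
From mathcomp Require Import all_classical all_reals all_analysis.

Set Implicit Arguments.
Unset Strict Implicit.
Unset Printing Implicit Defensive.

Import Order.TTheory GRing.Theory Num.Theory.
Import numFieldNormedType.Exports.

Local Open Scope classical_set_scope.
Local Open Scope ring_scope.

(* Finite-dimensional real Hilbert spaces: the norm is the one induced by the
   inner product, positive definiteness comes from the norm axioms, and
   completeness is automatic in finite dimension. *)
HB.mixin Record NormedModule_hasInner (R : realType) V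
    of NormedModule R V & Vector R V := {
  inner : V -> V -> R ;
  innerC : forall u v, inner u v = inner v u ;
  innerDl : forall u v w, inner (u + v) w = inner u w + inner v w ;
  innerZl : forall a u v, inner (a *: u) v = a * inner u v ;
  inner_norm : forall u, inner u u = `|u| ^+ 2
}.

#[short(type="fdHilbertType")]
HB.structure Definition FdHilbert (R : realType) :=
  { V of NormedModule R V & Vector R V & NormedModule_hasInner R V }.

(* R^l is 'rV[R]_l; the library's norm on matrices is the max norm, hence the
   separate Euclidean norm. *)
Section RowVectors.
Context {R : realType} {l : nat}.
Implicit Types u v : 'rV[R]_l.

Definition dotv u v : R := \sum_(i < l) u 0 i * v 0 i.
Definition enorm u : R := Num.sqrt (dotv u u).
Definition vle u v : Prop := forall i, u 0 i <= v 0 i.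
Definition vmax u v : 'rV[R]_l := map2_mx Num.max u v.
Definition vmin u v : 'rV[R]_l := map2_mx Num.min u v.

End RowVectors.

Section Distances.
Context {R : realType}.

Definition prodnorm (U V : Type) (NU : U -> R) (NV : V -> R) (z : U * V) : R :=
  Num.sqrt (NU z.1 ^+ 2 + NV z.2 ^+ 2).

(* For nonempty closed convex C in finite dimension the infimum is attained. *)
Definition dist (V : zmodType) (N : V -> R) (z : V) (C : set V) : R :=
  inf [set N (z - z') | z' in C].

End Distances.

Section ConvexAnalysis.
Context {R : realType} {X : fdHilbertType R}.
Local Open Scope ereal_scope.

Definition proper_function (f : X -> \bar R) : Prop :=
  (forall x, -oo < f x) /\ (exists x, f x < +oo).

Definition closed_function (f : X -> \bar R) : Prop :=
  closed [set p : X * R | f p.1 <= p.2%:E].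

(* Only used for functions that never take the value -oo, so that the right-hand
   side is unambiguous; here 0 * +oo = 0. *)
Definition econvex (f : X -> \bar R) : Prop :=
  forall (x y : X) (t : R), (0 <= t <= 1)%R ->
    f (t *: x + (1 - t) *: y)%R <= t%:E * f x + (1 - t)%:E * f y.

Definition subdiff (f : X -> \bar R) (x : X) : set X :=
  [set y | forall x', f x + (inner y (x' - x)%R)%:E <= f x'].

Local Open Scope ring_scope.

(* Riesz representative of the differential; at a point of differentiability it
   exists and is unique, so the default 0 is irrelevant. *)
Definition grad (phi : X -> R) (x : X) : X :=
  xget 0 [set v : X | forall u, 'd (phi : X -> R^o) x u = inner v u].

Definition cont_differentiable (phi : X -> R) : Prop :=
  (forall x, differentiable (phi : X -> R^o) x) /\ continuous (grad phi).

Definition affine_map (m : nat) (h : X -> 'rV[R]_m) : Prop :=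
  exists (A : {linear X -> 'rV[R]_m}) (b : 'rV[R]_m), forall x, h x = A x + b.

End ConvexAnalysis.

Section ConvexProgram.
Context {R : realType} {X : fdHilbertType R} {m1 m2 : nat}.
Variables (f : X -> \bar R) (h : X -> 'rV[R]_m1) (g : X -> 'rV[R]_m2).

Definition pnorm : 'rV[R]_m1 * 'rV[R]_m2 -> R := prodnorm enorm enorm.
Definition znorm : X * ('rV[R]_m1 * 'rV[R]_m2) -> R :=
  prodnorm (fun x : X => `|x|) pnorm.

Definition feasible : set X := [set x | h x = 0 /\ vle (g x) 0].

Definition primal_solutions : set X :=
  [set x | feasible x /\ forall x', feasible x' -> (f x <= f x')%E].

Definition lagrangian (x : X) (lam : 'rV[R]_m1) (mu : 'rV[R]_m2) : \bar R :=
  if `[< vle 0 mu >] then (f x + (dotv lam (h x) + dotv mu (g x))%:E)%E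
  else -oo%E.

Definition dual_function (lam : 'rV[R]_m1) (mu : 'rV[R]_m2) : \bar R :=
  ereal_inf [set lagrangian x lam mu | x in [set: X]].

Definition dual_solutions : set ('rV[R]_m1 * 'rV[R]_m2) :=
  [set p | forall lam mu, (dual_function lam mu <= dual_function p.1 p.2)%E].

Definition lagrangian_subdiff (z : X * ('rV[R]_m1 * 'rV[R]_m2)) :
    set (X * ('rV[R]_m1 * 'rV[R]_m2)) :=
  let: (x, (lam, mu)) := z in
  [set beta | let: (y, (u, v)) := beta in
    (forall x', lagrangian x lam mu + (inner y (x' - x)%R)%:E
                <= lagrangian x' lam mu)%E /\
    (forall lam' mu', lagrangian x lam' mu'
       <= lagrangian x lam mu
          - (dotv u (lam' - lam)%R)%:E - (dotv v (mu' - mu)%R)%:E)%E].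

Definition lagrangian_subdiff_inv (beta : X * ('rV[R]_m1 * 'rV[R]_m2)) :
    set (X * ('rV[R]_m1 * 'rV[R]_m2)) :=
  [set z | lagrangian_subdiff z beta].

Definition KKT (x : X) (lam : 'rV[R]_m1) (mu : 'rV[R]_m2) : Prop :=
  [/\ exists2 s, subdiff f x s &
        0 = s + \sum_(i < m1) lam 0 i *: grad (fun x' => h x' 0 i) x
              + \sum_(i < m2) mu 0 i *: grad (fun x' => g x' 0 i) x,
      h x = 0, vle (g x) 0, vle 0 mu & dotv mu (g x) = 0].

Definition aug_lagrangian (c : R) (x : X)
    (lam : 'rV[R]_m1) (mu : 'rV[R]_m2) : \bar R :=
  (f x + (dotv lam (h x) + c / 2 * enorm (h x) ^+ 2
          + 1 / (2 * c) * \sum_(i < m2)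
              (Num.max 0 (mu 0 i + c * g x 0 i) ^+ 2 - mu 0 i ^+ 2))%:E)%E.

(* x k, y k and c k are meaningful for k >= 1 only; their values at 0 are
   unconstrained. *)
Definition inexact_ALM (sigma : R) (c : nat -> R) (x y w : nat -> X)
    (lam : nat -> 'rV[R]_m1) (mu : nat -> 'rV[R]_m2) : Prop :=
  vle 0 (mu 0%N) /\
  forall k, (1 <= k)%N ->
    [/\ subdiff (fun x' => aug_lagrangian (c k) x' (lam k.-1) (mu k.-1))
          (x k) (y k),
        2 / c k * `|inner (w k.-1 - x k) (y k)| + `|y k| ^+ 2
          <= sigma * (enorm (h (x k)) ^+ 2
                      + enorm (vmin ((c k)^-1 *: mu k.-1) (- g (x k))) ^+ 2),
        lam k = lam k.-1 + c k *: h (x k),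
        mu k = vmax 0 (mu k.-1 + c k *: g (x k)) &
        w k = w k.-1 - c k *: y k].

Definition locally_upper_Lipschitz (kappa eps : R) : Prop :=
  lagrangian_subdiff_inv 0 !=set0 /\
  forall beta, znorm beta <= eps ->
    forall z, lagrangian_subdiff_inv beta z ->
      dist znorm z (lagrangian_subdiff_inv 0) <= kappa * znorm beta.

End ConvexProgram.

Definition Q_linear {R : realType} (u : nat -> R) : Prop :=
  exists2 q, 0 <= q < 1 & \forall k \near \oo, u k <= q * u k.-1.

Definition rate_modulus {R : realType} (kappa sigma : R) (c : nat -> R)
    (k : nat) : R :=
  kappa * Num.sqrt (1 + sigma)
  / Num.sqrt (c k ^+ 2 - 2 * kappa * (sigma + Num.sqrt sigma) * c k
              + kappa ^+ 2 * (1 + sigma)).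

(* Main.v *)
Require Import Defs.
From HB Require Import structures.
From mathcomp Require Import all_boot all_order all_algebra.
From mathcomp Require Import all_classical all_reals all_analysis.
From mathcomp Require Import ring lra.

Import Order.TTheory GRing.Theory Num.Theory.
Import numFieldNormedType.Exports.

Local Open Scope classical_set_scope.
Local Open Scope ring_scope.

(** An exact step of the method of multipliers is a proximal step on the convex-
    concave Lagrangian, and the update of the multipliers is its dual component:
    writing [p] for the pair of multipliers, a point at which the augmented
    Lagrangian has the subgradient [y] satisfies, at the updated multipliers, the
    Lagrangian inclusion with residual made of [y] and of the scaled displacement
    [(c k)^-1 *: (p k.-1 - p k)] ([aug_subdiff_lagrangian], [ALM_step]). The
    relative error criterion says that [y] is dominated by that displacement.

    The subdifferential of the Lagrangian is monotone
    ([lagrangian_subdiff_mono]). Against a saddle point this makes the squared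
    distance of the pair made of [w k] and [p k] nonincreasing, with a decrease of
    at least [(1 - sigma)] times the squared displacement ([ALM_Fejer]). Hence the
    displacements, and with them the residuals, tend to zero, so the Lipschitz
    bound on the inverse subdifferential eventually applies to the iterates. The
    saddle points form the product of the primal and the dual solution sets
    ([saddle_solutions]), and on a product the squared distances add up
    ([dist_prod]): the distances to both solution sets are therefore at most a
    constant times the scaled displacement ([ALM_error_bound]). The primal half of
    this is the first claim.

    For the rate, expand the square of [p k.-1 - q] around [p k], for [q] a dual
    solution. The cross term is bounded below by monotonicity, up to [y] times
    the distance of [x k] to the primal solutions, which the error bound makes
    quadratic in the displacement. The squared distance to the dual solutions thus
    decreases by a multiple of the squared displacement ([ALM_dual_descent]),
    which by the error bound again is at least a multiple of the new squared
    distance; this is the contraction, with the stated modulus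
    ([le_rate_modulus]). *)

(** * Inner products, Euclidean norms and distances *)

Section InnerProduct.
Context {R : realType} {X : fdHilbertType R}.
Implicit Types u v w : X.

Lemma innerNl u v : inner (- u) v = - inner u v.
Proof. by rewrite -scaleN1r innerZl mulN1r. Qed.

Lemma innerBl u v w : inner (u - v) w = inner u w - inner v w.
Proof. by rewrite innerDl innerNl. Qed.

Lemma innerDr u v w : inner u (v + w) = inner u v + inner u w.
Proof. by rewrite innerC innerDl !(innerC u). Qed.

Lemma innerZr a u v : inner u (a *: v) = a * inner u v.
Proof. by rewrite innerC innerZl innerC. Qed.

Lemma innerNr u v : inner u (- v) = - inner u v.
Proof. by rewrite innerC innerNl innerC. Qed.

Lemma innerBr u v w : inner u (v - w) = inner u v - inner u w.
Proof. by rewrite innerDr innerNr. Qed.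

Lemma inner0l v : inner (0 : X) v = 0.
Proof. by rewrite -(scale0r (0 : X)) innerZl mul0r. Qed.

Lemma inner_ge0 u : 0 <= inner u u.
Proof. by rewrite inner_norm sqr_ge0. Qed.

Lemma Cauchy_Schwarz u v : `|inner u v| <= `|u| * `|v|.
Proof.
have [->|v0] := eqVneq v 0.
  by rewrite innerC inner0l normr0 mulr_ge0.
rewrite -ler_sqr ?nnegrE ?mulr_ge0// exprMn real_normK ?num_real//.
have vv0 : 0 < `|v| ^+ 2 by rewrite exprn_gt0// normr_gt0.
rewrite -(ler_pM2l vv0) -subr_ge0.
(* the squared norm of a multiple of the component of u orthogonal to v *)
have := inner_ge0 (`|v| ^+ 2 *: u - inner u v *: v).
rewrite !(innerBl, innerBr, innerZl, innerZr) !inner_norm (innerC v u).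
by congr (0 <= _); ring.
Qed.

End InnerProduct.

Section DotProduct.
Context {R : realType} {l : nat}.
Implicit Types u v w : 'rV[R]_l.

Lemma dotvC u v : dotv u v = dotv v u.
Proof. by apply: eq_bigr => i _; rewrite mulrC. Qed.

Lemma dotvDl u v w : dotv (u + v) w = dotv u w + dotv v w.
Proof. by rewrite -big_split; apply: eq_bigr => i _; rewrite mxE mulrDl. Qed.

Lemma dotvZl a u v : dotv (a *: u) v = a * dotv u v.
Proof. by rewrite /dotv mulr_sumr; apply: eq_bigr => i _; rewrite mxE mulrA. Qed.

Lemma dotvDr u v w : dotv u (v + w) = dotv u v + dotv u w.
Proof. by rewrite dotvC dotvDl !(dotvC u). Qed.

Lemma dotvZr a u v : dotv u (a *: v) = a * dotv u v.
Proof. by rewrite dotvC dotvZl dotvC. Qed.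

Lemma dotvNl u v : dotv (- u) v = - dotv u v.
Proof. by rewrite -scaleN1r dotvZl mulN1r. Qed.

Lemma dotvNr u v : dotv u (- v) = - dotv u v.
Proof. by rewrite dotvC dotvNl dotvC. Qed.

Lemma dotv0l v : dotv 0 v = 0.
Proof. by rewrite -(scale0r v) dotvZl mul0r. Qed.

Lemma dotv_ge0 u : 0 <= dotv u u.
Proof. by apply: sumr_ge0 => i _; rewrite -expr2 sqr_ge0. Qed.

Lemma dotv_le0 {u v} : vle 0 u -> vle v 0 -> dotv u v <= 0.
Proof.
move=> u0 v0; apply: sumr_le0 => i _; rewrite mulr_ge0_le0//.
- by have := u0 i; rewrite mxE.
- by have := v0 i; rewrite mxE.
Qed.

Lemma dotv_eq0 u : dotv u u <= 0 -> u = 0.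
Proof.
move=> uu; have /eqP : dotv u u = 0 by apply/eqP; rewrite eq_le uu dotv_ge0.
rewrite psumr_eq0 => [/allP u0|i _]; last by rewrite -expr2 sqr_ge0.
apply/rowP => i; rewrite mxE; apply/eqP.
by have := u0 i (mem_index_enum _); rewrite /= -expr2 sqrf_eq0.
Qed.

Lemma dotv_delta (i : 'I_l) v : dotv (delta_mx 0 i) v = v 0 i.
Proof.
rewrite /dotv (bigD1 i)//= mxE !eqxx mul1r big1 ?addr0// => j ji.
by rewrite mxE (negbTE ji) andbF mul0r.
Qed.

Lemma enorm_sqr u : enorm u ^+ 2 = dotv u u.
Proof. by rewrite sqr_sqrtr// dotv_ge0. Qed.

End DotProduct.

Definition dotvE := (@dotvDl, @dotvDr, @dotvNl, @dotvNr, @dotvZl, @dotvZr).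

Section ProductNorms.
Context {R : realType}.

Lemma prodnorm_sqr (U V : Type) (NU : U -> R) (NV : V -> R) z :
  prodnorm NU NV z ^+ 2 = NU z.1 ^+ 2 + NV z.2 ^+ 2.
Proof. by rewrite sqr_sqrtr// addr_ge0// sqr_ge0. Qed.

Lemma prodnorm_ge0 (U V : Type) (NU : U -> R) (NV : V -> R) z :
  0 <= prodnorm NU NV z.
Proof. exact: sqrtr_ge0. Qed.

Definition pdot {m1 m2} (p q : 'rV[R]_m1 * 'rV[R]_m2) : R :=
  dotv p.1 q.1 + dotv p.2 q.2.

Lemma pnorm_sqr m1 m2 (p : 'rV[R]_m1 * 'rV[R]_m2) : pnorm p ^+ 2 = pdot p p.
Proof. by rewrite prodnorm_sqr !enorm_sqr. Qed.

Lemma pnorm_ge0 m1 m2 (p : 'rV[R]_m1 * 'rV[R]_m2) : 0 <= pnorm p.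
Proof. exact: prodnorm_ge0. Qed.

End ProductNorms.

Section Distances.
Context {R : realType}.

Lemma dist_le (V : zmodType) (N : V -> R) (z z' : V) (C : set V) :
  (forall v, 0 <= N v) -> C z' -> dist N z C <= N (z - z').
Proof.
move=> N0 Cz'; apply: ge_inf; last by exists z'.
by exists 0 => _ [v _ <-].
Qed.

Lemma le_dist {V : zmodType} {N : V -> R} {z : V} {C : set V} {a : R} :
  C !=set0 -> (forall z', C z' -> a <= N (z - z')) -> a <= dist N z C.
Proof.
move=> [z' Cz'] aN; apply: lb_le_inf; first by exists (N (z - z')), z'.
by move=> _ [v Cv <-]; exact: aN.
Qed.

Lemma dist_ge0 (V : zmodType) (N : V -> R) (z : V) (C : set V) :
  C !=set0 -> (forall v, 0 <= N v) -> 0 <= dist N z C.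
Proof. by move=> C0 N0; apply: le_dist => // z' _. Qed.

Lemma dist_prod (U V : zmodType) (NU : U -> R) (NV : V -> R)
    (z : U * V) (A : set U) (B : set V) :
  (forall u, 0 <= NU u) -> (forall v, 0 <= NV v) -> A !=set0 -> B !=set0 ->
  dist NU z.1 A ^+ 2 + dist NV z.2 B ^+ 2
    <= dist (prodnorm NU NV) z (A `*` B) ^+ 2.
Proof.
move=> NU0 NV0 [a Aa] [b Bb].
have AB0 : A `*` B !=set0 by exists (a, b).
rewrite -[leLHS]sqr_sqrtr ?addr_ge0 ?sqr_ge0// ler_sqr ?nnegrE ?sqrtr_ge0//;
  last by apply: dist_ge0 => // v; exact: prodnorm_ge0.
apply: le_dist => // -[u v] [/= Au Bv].
rewrite -ler_sqr ?nnegrE ?sqrtr_ge0// prodnorm_sqr sqr_sqrtr;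
  last by rewrite addr_ge0 ?sqr_ge0.
by rewrite lerD// ler_sqr ?nnegrE ?dist_le ?dist_ge0//; [exists a|exists b].
Qed.

End Distances.

(** * The Lagrangian and its saddle points *)

Section Lagrangian.
Context {R : realType} {X : fdHilbertType R} {m1 m2 : nat}.
Variables (f : X -> \bar R) (h : X -> 'rV[R]_m1) (g : X -> 'rV[R]_m2).
Hypothesis f_proper : proper_function f.
Implicit Types (x y : X) (lam u : 'rV[R]_m1) (mu v : 'rV[R]_m2).
Local Notation L := (lagrangian f h g).
Local Notation dL := (lagrangian_subdiff f h g).
Local Notation saddle := (lagrangian_subdiff_inv f h g 0).

Lemma lagrangianE x lam mu : vle 0 mu ->
  L x lam mu = (f x + (dotv lam (h x) + dotv mu (g x))%:E)%E.
Proof. by move=> mu0; rewrite /lagrangian asboolT. Qed.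

Lemma lagrangianNy x lam mu : ~ vle 0 mu -> L x lam mu = -oo%E.
Proof. by move=> mu0; rewrite /lagrangian asboolF. Qed.

Lemma vle00 : vle (0 : 'rV[R]_m2) 0.
Proof. by move=> i; rewrite mxE. Qed.

(** Properness of [f] is what makes the values of the Lagrangian finite on the
    domain of its subdifferential, so that subgradient inequalities there can be
    handled as inequalities between reals. *)
Lemma lagrangian_subdiff_dom x lam mu b :
  dL (x, (lam, mu)) b -> f x \is a fin_num /\ vle 0 mu.
Proof.
case: b => y [u v] [Lx Lp]; have [fNy [x0 fx0]] := f_proper.
have mu0 : vle 0 mu.
  apply: contrapT => mu0; have := Lp lam 0.
  rewrite (lagrangianNy _ _ _ mu0) lagrangianE ?addNye; last exact: vle00.
  by rewrite leeNy_eq; have := fNy x; case: (f x).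
split=> //; rewrite fin_numE; apply/andP; split; first by rewrite gt_eqF.
have := Lx x0; rewrite !lagrangianE//; have := fNy x0.
by case: (f x0) fx0 => //; case: (f x).
Qed.

Lemma lagrangian_fin x lam mu : f x \is a fin_num -> vle 0 mu ->
  L x lam mu = (fine (f x) + (dotv lam (h x) + dotv mu (g x)))%:E.
Proof. by move=> fx mu0; rewrite lagrangianE// -{1}(fineK fx). Qed.

(** The Lagrangian is convex-concave, and its subdifferential is monotone: add
    the four subgradient inequalities that compare the two points. *)
Lemma lagrangian_subdiff_mono z1 z2 b1 b2 : dL z1 b1 -> dL z2 b2 ->
  0 <= inner (b1.1 - b2.1) (z1.1 - z2.1) + pdot (b1.2 - b2.2) (z1.2 - z2.2).
Proof.
case: z1 z2 b1 b2 => [x1 [lam1 mu1]] [x2 [lam2 mu2]] [y1 [u1 v1]] [y2 [u2 v2]].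
move=> d1 d2; have [f1 mu10] := lagrangian_subdiff_dom _ _ _ _ d1.
have [f2 mu20] := lagrangian_subdiff_dom _ _ _ _ d2.
have [Lx1 Lp1] := d1; have [Lx2 Lp2] := d2.
have := Lx1 x2; have := Lp1 lam2 mu2; have := Lx2 x1; have := Lp2 lam1 mu1.
rewrite !lagrangian_fin// -?EFinN -!EFinD !lee_fin /pdot /=.
rewrite !(innerBl, innerBr) !dotvE; lra.
Qed.

Lemma saddleP x lam mu : saddle (x, (lam, mu)) <->
  (forall x', (L x lam mu <= L x' lam mu)%E) /\
  (forall lam' mu', (L x lam' mu' <= L x lam mu)%E).
Proof.
rewrite /lagrangian_subdiff_inv /lagrangian_subdiff /=.
by split=> -[Lx Lp]; split=> [x'|lam' mu'];
  [have := Lx x'|have := Lp lam' mu'|have := Lx x'|have := Lp lam' mu'];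
  rewrite ?inner0l ?dotv0l ?oppr0 ?adde0 ?sube0.
Qed.

(** A multiplier may be moved along [h x] and along each coordinate, and the
    inequality multipliers may be set to zero; that none of this increases the
    Lagrangian forces feasibility and complementarity. *)
Lemma saddle_feasible x lam mu : saddle (x, (lam, mu)) ->
  feasible h g x /\ dotv mu (g x) = 0.
Proof.
move=> zs; have [fx mu0] := lagrangian_subdiff_dom _ _ _ _ zs.
have [_ Lp] := (saddleP _ _ _).1 zs.
have hx : h x = 0.
  apply: dotv_eq0; have := Lp (lam + h x) mu.
  by rewrite !lagrangian_fin// lee_fin !dotvE; lra.
have gx : vle (g x) 0.
  move=> i; rewrite mxE.
  have mui : vle 0 (mu + delta_mx 0 i).
    by move=> j; rewrite !mxE addr_ge0 ?ler0n//; have := mu0 j; rewrite mxE.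
  have := Lp lam (mu + delta_mx 0 i).
  by rewrite !lagrangian_fin// lee_fin dotvDl dotv_delta; lra.
split=> //; apply/eqP; rewrite eq_le (dotv_le0 mu0 gx)/=.
have := Lp lam 0; rewrite !lagrangian_fin ?lee_fin ?dotv0l//; lra.
Qed.

Lemma dual_le x lam mu : (dual_function f h g lam mu <= L x lam mu)%E.
Proof. by apply: ereal_inf_lbound; exists x. Qed.

Lemma lagrangian_feasible_le x lam mu : feasible h g x -> (L x lam mu <= f x)%E.
Proof.
move=> [hx gx]; have [mu0|mu0] := pselect (vle 0 mu); last first.
  by rewrite lagrangianNy// leNye.
rewrite lagrangianE// hx (dotvC lam) dotv0l add0r -[leRHS]adde0 leeD2l//.
by rewrite lee_fin dotv_le0.
Qed.

(** Once a saddle point exists there is no duality gap, and then a primal and a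
    dual solution may be paired at will: the common optimal value lies between
    the dual function and the objective, and squeezes the Lagrangian. *)
Lemma saddle_solutions : saddle !=set0 ->
  saddle = primal_solutions f h g `*` dual_solutions f h g.
Proof.
have sol x lam mu : saddle (x, (lam, mu)) ->
    [/\ primal_solutions f h g x, dual_solutions f h g (lam, mu) &
        dual_function f h g lam mu = f x].
  move=> zs; have [[hx gx] mug] := saddle_feasible _ _ _ zs.
  have [fx mu0] := lagrangian_subdiff_dom _ _ _ _ zs.
  have [Lx Lp] := (saddleP _ _ _).1 zs.
  have Lfx : L x lam mu = f x.
    by rewrite lagrangianE// mug hx dotvC dotv0l addr0 adde0.
  have dfx : dual_function f h g lam mu = f x.
    apply/eqP; rewrite eq_le -{1}Lfx dual_le/=.
    by apply: le_ereal_inf_tmp => _ [x' _ <-]; rewrite -Lfx.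
  split=> //.
  - split=> // x' x'feas; rewrite -Lfx; apply: le_trans (Lx x') _.
    exact: lagrangian_feasible_le.
  - move=> lam' mu' /=; rewrite dfx -Lfx; apply: le_trans (Lp lam' mu').
    exact: dual_le.
move=> [[x0 [lam0 mu0]] z0s].
have [[x0feas x0min] p0max d0] := sol _ _ _ z0s.
have [fx0 _] := lagrangian_subdiff_dom _ _ _ _ z0s.
apply/seteqP; split=> [[x [lam mu]] zs|[x [lam mu]] [/= [xfeas xmin] pmax]].
  by have [] := sol _ _ _ zs.
have fx : f x = f x0 by apply/eqP; rewrite eq_le xmin//= x0min.
have dfx : dual_function f h g lam mu = f x.
  by apply/eqP; rewrite eq_le fx -d0 [X in X && _]p0max/= (pmax lam0 mu0).
have Lfx : L x lam mu = f x.
  by apply/eqP; rewrite eq_le lagrangian_feasible_le//= -{1}dfx dual_le.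
apply/saddleP; rewrite Lfx; split=> [x'|lam' mu'].
  by rewrite -dfx dual_le.
exact: lagrangian_feasible_le.
Qed.

End Lagrangian.

(** * The multiplier update as a step in the dual *)

Section AugmentedLagrangian.
Context {R : realType}.

Lemma pos_part_ge0 (a : R) : 0 <= Num.max 0 a.
Proof. by rewrite le_max lexx. Qed.

(** The square of the positive part has a 2-Lipschitz derivative, hence this
    quadratic upper bound. *)
Lemma sqr_pos_part_le (a b : R) :
  Num.max 0 b ^+ 2
    <= Num.max 0 a ^+ 2 + 2 * Num.max 0 a * (b - a) + (b - a) ^+ 2.
Proof.
have sq := sqr_ge0 (b - a); have sb := sqr_ge0 b.
by rewrite !maxEle; case: (leP 0 a) => ?; case: (leP 0 b) => ?; nra.
Qed.

Lemma le_of_vanishing_slope (a b K : R) : 0 <= K ->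
  (forall t, 0 < t <= 1 -> a <= b + t * K) -> a <= b.
Proof.
move=> K0 abt; apply/ler_addgt0Pr => e e0.
have K1 : 0 < K + 1 by lra.
have t0 : 0 < Num.min 1 (e / (K + 1)) by rewrite lt_min ltr01 divr_gt0.
have := abt (Num.min 1 (e / (K + 1))); rewrite t0 ge_min lexx => /(_ isT).
move=> /le_trans; apply; rewrite lerD2l.
apply: (@le_trans _ _ (e / (K + 1) * K)).
  by rewrite ler_wpM2r// ge_min lexx orbT.
by rewrite -mulrA ger_pMr// mulrC ler_pdivrMr//; lra.
Qed.

Context {X : fdHilbertType R} {m1 m2 : nat}.
Variables (f : X -> \bar R) (h : X -> 'rV[R]_m1) (g : X -> 'rV[R]_m2).
Hypothesis f_proper : proper_function f.
Hypothesis f_convex : econvex f.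
Hypothesis h_affine : affine_map h.
Hypothesis g_convex : forall i : 'I_m2,
  convex_function setT (fun x : X => g x 0 i : R^o).

Lemma convex_constraint x x' (i : 'I_m2) (t : R) : 0 <= t <= 1 ->
  g (t *: x' + (1 - t) *: x) 0 i <= t * g x' 0 i + (1 - t) * g x 0 i.
Proof.
move=> /andP[t0 t1].
by have := g_convex i (Itv01 t0 t1) x' x; rewrite !in_setT => /(_ isT isT).
Qed.

Lemma affine_combination x x' (t : R) :
  h (t *: x' + (1 - t) *: x) = h x + t *: (h x' - h x).
Proof.
have [A [b hE]] := h_affine; rewrite !hE linearD !linearZ/=.
by apply/rowP => i; rewrite !mxE; ring.
Qed.

Definition augmentation (c : R) (lam : 'rV[R]_m1) (mu : 'rV[R]_m2) (x : X) : R :=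
  dotv lam (h x) + c / 2 * enorm (h x) ^+ 2
  + 1 / (2 * c) * \sum_(i < m2)
      (Num.max 0 (mu 0 i + c * g x 0 i) ^+ 2 - mu 0 i ^+ 2).

(** Along a segment the augmentation exceeds its value at the starting point
    by at most a linear term, whose slope is the increment of the Lagrangian at
    the updated multipliers, and a quadratic one. The nonlinear constraints
    are compared with their chords by convexity, which is legitimate because the
    positive part is nondecreasing. *)
Lemma augmentation_segment c lam mu x x' : 0 < c -> exists2 K, 0 <= K &
  forall t, 0 < t <= 1 ->
    augmentation c lam mu (t *: x' + (1 - t) *: x)
      <= augmentation c lam mu x
         + t * (dotv (lam + c *: h x) (h x' - h x)
                + dotv (vmax 0 (mu + c *: g x)) (g x' - g x))
         + t ^+ 2 * K.
Proof.
move=> c0.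
exists (c / 2 * (dotv (h x' - h x) (h x' - h x)
                 + dotv (g x' - g x) (g x' - g x))).
  by rewrite mulr_ge0 ?addr_ge0 ?dotv_ge0//; lra.
move=> t /andP[t0 t1].
set xt := t *: x' + (1 - t) *: x.
set D := g x' - g x.
set s := vmax 0 (mu + c *: g x).
have sumle : \sum_(i < m2) (Num.max 0 (mu 0 i + c * g xt 0 i) ^+ 2 - mu 0 i ^+ 2)
    <= \sum_(i < m2) (Num.max 0 (mu 0 i + c * g x 0 i) ^+ 2 - mu 0 i ^+ 2)
       + 2 * c * t * dotv s D + c ^+ 2 * t ^+ 2 * dotv D D.
  rewrite /dotv !mulr_sumr -!big_split/=; apply: ler_sum => i _.
  rewrite /s /D !mxE.
  have git := convex_constraint x x' i t; rewrite ltW//= t1 in git.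
  have {}git := git isT.
  (* the argument of the positive part on the chord *)
  pose b := mu 0 i + c * (t * g x' 0 i + (1 - t) * g x 0 i).
  have maxle : Num.max 0 (mu 0 i + c * g xt 0 i) ^+ 2 <= Num.max 0 b ^+ 2.
    rewrite ler_sqr ?nnegrE ?pos_part_ge0// ge_max pos_part_ge0/=.
    by rewrite le_max lerD2l ler_pM2l// git orbT.
  have := sqr_pos_part_le (mu 0 i + c * g x 0 i) b.
  by move: maxle; rewrite /b; nra.
rewrite /augmentation !enorm_sqr affine_combination !dotvE.
rewrite (dotvC (h x') (h x)).
have c20 : 0 <= 1 / (2 * c) by rewrite divr_ge0//; lra.
have := ler_wpM2l c20 sumle.
set S1 := \sum_(_ < _) _; set S2 := \sum_(_ < _) _.
rewrite (_ : 1 / (2 * c) * (S2 + _ + _) =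
   1 / (2 * c) * S2 + t * dotv s D + c / 2 * t ^+ 2 * dotv D D); last first.
  by field; rewrite gt_eqF.
rewrite /D !dotvE (dotvC (g x') (g x)).
lra.
Qed.

(** A point with subgradient [y] of the augmented Lagrangian, followed by the
    multiplier update, is a step of the method of multipliers seen as an
    inexact proximal point method: its residual is [y] in the primal variable
    and the scaled displacement in the multipliers. *)
Lemma aug_subdiff_lagrangian c lam mu x y : 0 < c ->
  subdiff (fun x' => aug_lagrangian f h g c x' lam mu) x y ->
  lagrangian_subdiff f h g (x, (lam + c *: h x, vmax 0 (mu + c *: g x)))
    (y, (- h x, vmin (c^-1 *: mu) (- g x))).
Proof.
move=> c0 xy; set lam' := lam + _; set mu' := vmax _ _.
have mu'0 : vle 0 mu' by move=> i; rewrite !mxE le_max lexx.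
have subx x' : (f x + (augmentation c lam mu x + inner y (x' - x))%:E
                  <= f x' + (augmentation c lam mu x')%:E)%E.
  by have := xy x'; rewrite /aug_lagrangian -addeA.
have fx : f x \is a fin_num.
  have [fNy [x0 fx0]] := f_proper.
  rewrite fin_numE gt_eqF//=; have := subx x0; have := fNy x0.
  by case: (f x0) fx0 => //; case: (f x).
split=> [x'|lam2 mu2].
- rewrite !lagrangianE//; have [fx'|fx'] := boolP (f x' \is a fin_num); last first.
    have -> : f x' = +oo%E.
      by move: fx' ((f_proper.1) x'); case: (f x').
    by rewrite addye// leey.
  (* compare along the segment from [x] to [x'] and let its length tend to 0 *)
  have [K K0 Kle] := augmentation_segment c lam mu x x' c0.
  rewrite -(fineK fx) -(fineK fx') -!EFinD lee_fin.
  apply: (le_of_vanishing_slope _ _ K) => // t t01.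
  have /andP[t0 t1] := t01.
  set xt := t *: x' + (1 - t) *: x.
  have fxt : (f xt <= (t * fine (f x') + (1 - t) * fine (f x))%:E)%E.
    rewrite EFinD !EFinM !fineK//; apply: f_convex; rewrite ltW//.
  have fxtfin : f xt \is a fin_num.
    rewrite fin_numE gt_eqF ?(f_proper.1)//=.
    by rewrite lt_eqF// (le_lt_trans fxt) ?ltry.
  move: fxt (subx xt) (Kle t t01).
  rewrite -{1 2}(fineK fxtfin) -(fineK fx) -!EFinD !lee_fin.
  have -> : xt - x = t *: (x' - x).
    by rewrite /xt scalerBl scale1r scalerBr addrA addrAC addrK.
  rewrite innerZr -/xt !dotvE => A B C.
  rewrite -(ler_pM2l t0); lra.
- have [mu20|mu20] := pselect (vle 0 mu2); last by rewrite lagrangianNy// leNye.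
  rewrite !lagrangianE// -(fineK fx) -?EFinN -!EFinD lee_fin.
  (* the right factor is nonpositive, and zero where [mu'] is positive *)
  suff : dotv (mu2 - mu') (g x + vmin (c^-1 *: mu) (- g x)) <= 0.
    by rewrite !dotvE !(dotvC (h x)) !(dotvC (vmin _ _)); lra.
  apply: sumr_le0 => i _; have := mu20 i; rewrite !mxE => mu2i.
  have [gi|gi] := leP (c^-1 * mu 0 i) (- g x 0 i); last by rewrite subrr mulr0.
  have ngi : g x 0 i + c^-1 * mu 0 i <= 0 by lra.
  rewrite max_l ?subr0; first by rewrite mulr_ge0_le0.
  by rewrite -(ler_pM2l (_ : 0 < c^-1)) ?invr_gt0// mulrDr mulKf ?gt_eqF//; lra.
Qed.

End AugmentedLagrangian.

(** * Convergence of the method *)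

Section ProductDot.
Context {R : realType} {m1 m2 : nat}.
Implicit Types a b q : 'rV[R]_m1 * 'rV[R]_m2.

Lemma pnorm_three_points a b q :
  pnorm (a - q) ^+ 2
    = pnorm (b - q) ^+ 2 + 2 * pdot (a - b) (b - q) + pnorm (a - b) ^+ 2.
Proof.
rewrite !pnorm_sqr /pdot /= !dotvE.
rewrite !(dotvC q.1) !(dotvC q.2) (dotvC b.1 a.1) (dotvC b.2 a.2); ring.
Qed.

Lemma pdotZl (t : R) a b : pdot (t *: a) b = t * pdot a b.
Proof. by rewrite /pdot /= !dotvZl mulrDr. Qed.

Lemma pdotZr (t : R) a b : pdot a (t *: b) = t * pdot a b.
Proof. by rewrite /pdot /= !dotvZr mulrDr. Qed.

End ProductDot.

Section DistanceBounds.
Context {R : realType} {V : zmodType}.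
Variables (N : V -> R) (z : V) (C : set V).
Hypotheses (C0 : C !=set0) (N0 : forall v, 0 <= N v).

Lemma le_mul_dist (a K : R) : 0 <= K ->
  (forall z', C z' -> a <= K * N (z - z')) -> a <= K * dist N z C.
Proof.
rewrite le_eqVlt => /predU1P[<-|K0] aK.
  by case: C0 => z' /aK; rewrite !mul0r.
rewrite mulrC -ler_pdivrMr//; apply: le_dist => // z' Cz'.
by rewrite ler_pdivrMr// mulrC aK.
Qed.

Lemma le_sqr_dist (a : R) :
  (forall z', C z' -> a <= N (z - z') ^+ 2) -> a <= dist N z C ^+ 2.
Proof.
move=> aN; have [a0|a0] := ltP a 0.
  by rewrite ltW// (lt_le_trans a0) ?sqr_ge0.
rewrite -[leLHS]sqr_sqrtr// ler_sqr ?nnegrE ?sqrtr_ge0 ?dist_ge0//.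
apply: le_dist => // z' /aN; rewrite -{1}[a]sqr_sqrtr//.
by rewrite ler_sqr ?nnegrE ?sqrtr_ge0.
Qed.

End DistanceBounds.

Section Limits.
Context {R : realType}.

Lemma limn_esup_le (u : nat -> \bar R) (l : \bar R) :
  (\forall k \near \oo, (u k <= l)%E) -> (limn_esup u <= l)%E.
Proof.
move=> [n _ un]; apply: (@le_trans _ _ (ereal_sup (u @` [set k | (n <= k)%N]))).
  by apply: ereal_inf_lbound; exists [set k | (n <= k)%N] => //; exists n.
by apply: ge_ereal_sup => _ [k nk <-]; exact: un.
Qed.

Lemma limn_einf_gt (u : nat -> R) (a : R) :
  (a%:E < limn_einf (fun k => (u k)%:E))%E ->
  exists2 d, 0 < d & \forall k \near \oo, a + d <= u k.
Proof.
rewrite /limn_einf /limn_esup /limf_esup lteNr => /ereal_inf_lt[_ [V Voo <-]].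
set M := ereal_sup _ => Ma.
have uM k : V k -> (- (u k)%:E <= M)%E.
  by move=> Vk; apply: ereal_sup_ubound; exists k.
have [d d0 Md] : exists2 d : R, 0 < d & (M <= (- (a + d))%:E)%E.
  move: Ma; case: (M) => [m| |] //; last by exists 1; rewrite ?leNye.
  rewrite -EFinN lte_fin => ma; exists (- a - m); first by lra.
  by rewrite lee_fin; lra.
exists d => //; apply: filterS Voo => k /uM /le_trans /(_ Md).
by rewrite -EFinN lee_fin lerN2.
Qed.

(** The modulus decreases as [c] moves away from the threshold, since
    [c ^+ 2 - a * c] is [c * (c - a)]. *)
Lemma rate_modulus_le (kappa sigma d : R) (c : nat -> R) k :
  0 < kappa -> 0 <= sigma -> 0 <= d ->
  2 * kappa * (sigma + Num.sqrt sigma) + d <= c k ->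
  rate_modulus kappa sigma c k
    <= kappa * Num.sqrt (1 + sigma)
       / Num.sqrt (d ^+ 2 + kappa ^+ 2 * (1 + sigma)).
Proof.
move=> k0 s0 d0; set a := 2 * _ * _ => ck.
have a0 : 0 <= a by rewrite !mulr_ge0 ?addr_ge0 ?sqrtr_ge0//; lra.
have K0 : 0 < kappa ^+ 2 * (1 + sigma) by rewrite mulr_gt0 ?exprn_gt0//; lra.
rewrite /rate_modulus -/a ler_wpM2l ?mulr_ge0 ?sqrtr_ge0//; first by lra.
have dd := sqr_ge0 d.
have : d ^+ 2 <= c k ^+ 2 - a * c k by nra.
by move=> ?; rewrite lef_pV2 ?posrE ?sqrtr_gt0 ?ler_sqrt//; lra.
Qed.

(** The first bound weighed by the nonnegative factor of [s] in the second, plus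
    the second weighed by the constant of the first, eliminates [s]. *)
Lemma le_rate_modulus (kappa sigma : R) (c : nat -> R) k (D D' s : R) :
  0 < kappa -> 0 <= sigma ->
  2 * kappa * (sigma + Num.sqrt sigma) <= c k -> 0 <= D -> 0 <= D' ->
  D ^+ 2 <= kappa ^+ 2 * (1 + sigma) * s ->
  D ^+ 2 + (c k ^+ 2 - 2 * kappa * (sigma + Num.sqrt sigma) * c k) * s
    <= D' ^+ 2 ->
  D <= rate_modulus kappa sigma c k * D'.
Proof.
move=> k0 s0; rewrite /rate_modulus; set a := 2 * _ * _ => ack D0 D'0.
have a0 : 0 <= a by rewrite !mulr_ge0 ?addr_ge0 ?sqrtr_ge0//; lra.
have Q0 : 0 <= c k ^+ 2 - a * c k.
  by rewrite expr2 -mulrBl mulr_ge0 ?subr_ge0// (le_trans a0).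
have K0 : 0 < kappa ^+ 2 * (1 + sigma) by rewrite mulr_gt0 ?exprn_gt0//; lra.
move: Q0; set Q := c k ^+ 2 - _ => Q0 DK DD'.
rewrite mulrAC ler_pdivlMr ?sqrtr_gt0; last by lra.
rewrite -ler_sqr ?nnegrE ?mulr_ge0 ?sqrtr_ge0 ?(ltW k0)//.
rewrite !exprMn !sqr_sqrtr; [|lra|lra].
by have := ler_wpM2l Q0 DK; have := ler_wpM2l (ltW K0) DD'; lra.
Qed.

End Limits.

Section Method.
Context {R : realType} {X : fdHilbertType R} {m1 m2 : nat}.
Variables (f : X -> \bar R) (h : X -> 'rV[R]_m1) (g : X -> 'rV[R]_m2).
Hypothesis f_proper : proper_function f.
Hypothesis f_convex : econvex f.
Hypothesis h_affine : affine_map h.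
Hypothesis g_convex : forall i : 'I_m2,
  convex_function setT (fun x : X => g x 0 i : R^o).
Variables (sigma : R) (c : nat -> R).
Hypothesis sigma_01 : 0 <= sigma < 1.
Hypothesis c_gt0 : forall k, (1 <= k)%N -> 0 < c k.
Variables (x y w : nat -> X) (lam : nat -> 'rV[R]_m1) (mu : nat -> 'rV[R]_m2).
Hypothesis alm : inexact_ALM f h g sigma c x y w lam mu.

Let p k := (lam k, mu k).
Local Notation saddle := (lagrangian_subdiff_inv f h g 0).
Local Notation Xstar := (primal_solutions f h g).
Local Notation Pstar := (dual_solutions f h g).
Local Notation distX k := (dist (fun v : X => `|v|) (x k) Xstar).
Local Notation distP k := (dist pnorm (p k) Pstar).

(** The norm of the dual part of the residual, by [ALM_step]. *)
Definition step_size k : R := pnorm (p k.-1 - p k) / c k.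

Lemma step_size_ge0 k : (1 <= k)%N -> 0 <= step_size k.
Proof. by move=> k1; rewrite divr_ge0 ?prodnorm_ge0// ltW// c_gt0. Qed.

Lemma ALM_step k : (1 <= k)%N ->
  [/\ lagrangian_subdiff f h g (x k, p k) (y k, (c k)^-1 *: (p k.-1 - p k)),
      2 / c k * `|inner (w k.-1 - x k) (y k)| + `|y k| ^+ 2
        <= sigma * step_size k ^+ 2 &
      w k = w k.-1 - c k *: y k].
Proof.
move=> k1; have [yk err lamk muk wk] := (alm.2 k k1); have c0 := c_gt0 k k1.
have cn0 : c k != 0 by rewrite gt_eqF.
have stepE : (c k)^-1 *: (p k.-1 - p k)
    = (- h (x k), vmin ((c k)^-1 *: mu k.-1) (- g (x k))).
  congr pair; rewrite /= ?lamk ?muk.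
    by rewrite opprD addNKr scalerN scalerA mulVf// scale1r.
  apply/rowP => i; rewrite !mxE.
  apply: (mulfI cn0); rewrite mulVKf//.
  have [H|H] := leP ((c k)^-1 * mu k.-1 0 i) (- g (x k) 0 i).
    rewrite mulVKf// max_l ?subr0//.
    by rewrite -(ler_pM2l c0) mulVKf// in H; lra.
  rewrite max_r; first by ring.
  by rewrite -(ltr_pM2l c0) mulVKf// in H; lra.
have sqE : step_size k ^+ 2 = pnorm ((c k)^-1 *: (p k.-1 - p k)) ^+ 2.
  by rewrite /step_size expr_div_n !pnorm_sqr pdotZl pdotZr; field.
split=> //; last first.
  by rewrite sqE stepE prodnorm_sqr !enorm_sqr/= dotvNl dotvNr opprK -!enorm_sqr.
rewrite stepE /p lamk muk.
exact: aug_subdiff_lagrangian.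
Qed.

(** The increments of [w] and [p] are both minus [c k] times the new residual, so
    expanding the squares produces its pairing with the offset from the saddle
    point, whose sign monotonicity gives. What is left is the pairing of [y k]
    with [w k.-1 - x k] and the square of [y k], exactly the two terms that the
    relative error criterion controls. *)
Lemma ALM_Fejer k xs ps : (1 <= k)%N -> saddle (xs, ps) ->
  `|w k - xs| ^+ 2 + pnorm (p k - ps) ^+ 2
    + (1 - sigma) * pnorm (p k.-1 - p k) ^+ 2
  <= `|w k.-1 - xs| ^+ 2 + pnorm (p k.-1 - ps) ^+ 2.
Proof.
move=> k1 zs; have [yk err wk] := ALM_step k k1; have c0 := c_gt0 k k1.
have := lagrangian_subdiff_mono _ _ _ f_proper _ _ _ _ yk zs.
rewrite /= !subr0 pdotZl (pnorm_three_points (p k.-1) (p k) ps).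
set r := p k.-1 - p k; set D := pdot r _ => mono.
have {}mono : 0 <= c k * inner (y k) (x k - xs) + D.
  by rewrite -(pmulr_rge0 _ (_ : 0 < (c k)^-1)) ?invr_gt0// mulrDr mulKf ?gt_eqF.
have {}err : 2 * c k * `|inner (w k.-1 - x k) (y k)| + c k ^+ 2 * `|y k| ^+ 2
    <= sigma * pnorm r ^+ 2.
  have := ler_wpM2l (sqr_ge0 (c k)) err; rewrite /step_size -/r.
  congr (_ <= _); last by field; rewrite gt_eqF.
  by field; rewrite gt_eqF.
have wE : `|w k - xs| ^+ 2 = `|w k.-1 - xs| ^+ 2
    - 2 * c k * (inner (w k.-1 - x k) (y k) + inner (y k) (x k - xs))
    + c k ^+ 2 * `|y k| ^+ 2.
  rewrite -!inner_norm wk !(innerBl, innerBr, innerZl, innerZr).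
  rewrite !(innerC (y k)) (innerC xs (w k.-1)); ring.
have := ler_norm (- inner (w k.-1 - x k) (y k)); rewrite normrN.
by rewrite -(ler_pM2l c0) wE; lra.
Qed.

Lemma ALM_displacement_cvg0 : saddle !=set0 ->
  pnorm (p k.-1 - p k) @[k --> \oo] --> (0 : R).
Proof.
move=> [[xs ps] zs].
pose E k := `|w k - xs| ^+ 2 + pnorm (p k - ps) ^+ 2.
have [s0 s1] := andP sigma_01.
have dE k : (1 - sigma) * pnorm (p k - p k.+1) ^+ 2 <= E k - E k.+1.
  by have := ALM_Fejer k.+1 xs ps isT zs; rewrite /= /E; lra.
have Edecr : nonincreasing_seq E.
  apply/nonincreasing_seqP => k; rewrite -subr_ge0 (le_trans _ (dE k))//.
  by rewrite mulr_ge0 ?sqr_ge0//; lra.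
have /cvg_ex[/= l El] : cvgn E.
  apply: nonincreasing_is_cvgn => //; exists 0 => _ [k _ <-].
  by rewrite addr_ge0 ?sqr_ge0.
have ES : E k.+1 @[k --> \oo] --> l by rewrite cvg_shiftS.
have dE0 : E k - E k.+1 @[k --> \oo] --> (0 : R).
  by rewrite -(subrr l); exact: cvgB.
rewrite -cvg_shiftS /=; apply/cvgr0Pnorm_le => e e0.
have e'0 : 0 < (1 - sigma) * e ^+ 2 by rewrite mulr_gt0 ?exprn_gt0//; lra.
move/cvgr0Pnorm_le : dE0 => /(_ _ e'0); apply: filterS => k /ler_normlW.
move=> /(le_trans (dE k)); rewrite ler_pM2l; last by lra.
by rewrite ger0_norm ?prodnorm_ge0// ler_sqr ?nnegrE ?prodnorm_ge0// ltW.
Qed.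

Variables kappa eps : R.
Hypotheses (kappa_gt0 : 0 < kappa) (eps_gt0 : 0 < eps).
Hypothesis upper_Lipschitz : locally_upper_Lipschitz f h g kappa eps.
Hypothesis c_bounded_below :
  exists2 c0 : R, 0 < c0 & forall k, (1 <= k)%N -> c0 <= c k.

Lemma step_size_cvg0 : step_size k @[k --> \oo] --> (0 : R).
Proof.
have [c0 c00 c0c] := c_bounded_below.
apply: (@squeeze_cvgr _ _ _ _ (fun=> 0) (fun k => c0^-1 * pnorm (p k.-1 - p k))).
- near=> k; have k1 : (1 <= k)%N by near: k; exact: nbhs_infty_gt.
  rewrite step_size_ge0//= /step_size mulrC ler_wpM2r ?prodnorm_ge0//.
  by rewrite lef_pV2 ?posrE ?c0c ?c_gt0.
- exact: cvg_cst.
- rewrite -[X in _ --> X](mulr0 c0^-1); apply: cvgMr.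
  by apply: ALM_displacement_cvg0; case: upper_Lipschitz.
Unshelve. all: by end_near. Qed.

(** The residual of the [k]-th iterate tends to zero, so the error bound
    eventually applies to it; on a product set it controls the primal and the
    dual distance together. *)
Lemma ALM_error_bound : \forall k \near \oo,
  (1 <= k)%N /\
  distX k ^+ 2 + distP k ^+ 2 <= kappa ^+ 2 * (1 + sigma) * step_size k ^+ 2.
Proof.
have [s0 s1] := andP sigma_01.
have [saddle0 uL] := upper_Lipschitz.
have XP := saddle_solutions _ _ _ f_proper saddle0.
have [[xs ps]] := saddle0; rewrite XP => -[/= Xxs Pps].
near=> k; have k1 : (1 <= k)%N by near: k; exact: nbhs_infty_gt.
split=> //; have [yk err _] := ALM_step k k1; have c0 := c_gt0 k k1.
set beta := (y k, _) in yk.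
have beta2 : znorm beta ^+ 2 <= (1 + sigma) * step_size k ^+ 2.
  rewrite prodnorm_sqr pnorm_sqr /= pdotZl pdotZr -pnorm_sqr mulrA -expr2.
  rewrite exprVn (mulrC _^-1) -expr_div_n -/(step_size k).
  have : 0 <= 2 / c k * `|inner (w k.-1 - x k) (y k)|.
    by rewrite mulr_ge0// divr_ge0// ltW.
  lra.
have beta_eps : znorm beta <= eps.
  rewrite -ler_sqr ?nnegrE ?prodnorm_ge0 ?(ltW eps_gt0)//.
  have : step_size k <= eps / 2.
    apply: ler_normlW; near: k; apply: cvgr0_norm_le; first exact: step_size_cvg0.
    by rewrite divr_gt0.
  have := step_size_ge0 k k1; nra.
have := uL beta beta_eps _ yk; rewrite XP => dz.
have := @dist_prod R _ _ (fun v : X => `|v|) pnorm (x k, p k) Xstar Pstar.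
move=> /(_ (@normr_ge0 _ _) (@pnorm_ge0 _ _ _)) /=.
move=> /(_ (ex_intro _ _ Xxs) (ex_intro _ _ Pps)) /le_trans; apply.
apply: (@le_trans _ _ ((kappa * znorm beta) ^+ 2)).
  rewrite ler_sqr ?nnegrE ?mulr_ge0 ?prodnorm_ge0 ?(ltW kappa_gt0)//.
  apply: dist_ge0; last exact: prodnorm_ge0.
  by exists (xs, ps).
by rewrite exprMn -mulrA ler_wpM2l ?sqr_ge0.
Unshelve. all: by end_near. Qed.

(** The three-point identity for the dual displacement, with the sign of the
    cross term given by monotonicity up to a product of the primal residual and
    the primal distance; the error bound turns the latter into a multiple of
    [step_size k ^+ 2]. *)
Lemma ALM_dual_descent k : saddle !=set0 -> (1 <= k)%N ->
  distX k ^+ 2 + distP k ^+ 2 <= kappa ^+ 2 * (1 + sigma) * step_size k ^+ 2 ->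
  distP k ^+ 2
    + (c k ^+ 2 - 2 * kappa * (sigma + Num.sqrt sigma) * c k) * step_size k ^+ 2
  <= distP k.-1 ^+ 2.
Proof.
move=> saddle0 k1 bound; have [s0 s1] := andP sigma_01.
have XP := saddle_solutions _ _ _ f_proper saddle0.
have [[xs ps]] := saddle0; rewrite XP => -[/= Xxs Pps].
have X0 : Xstar !=set0 by exists xs.
have P0 : Pstar !=set0 by exists ps.
have [yk err _] := ALM_step k k1; have c0 := c_gt0 k k1.
have sk0 := step_size_ge0 k k1.
set q : R := Num.sqrt sigma; have q0 : 0 <= q := sqrtr_ge0 _.
have qq : q ^+ 2 = sigma by rewrite sqr_sqrtr.
have ynorm : `|y k| <= q * step_size k.
  rewrite -ler_sqr ?nnegrE ?(mulr_ge0 q0 sk0)// exprMn qq.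
  have : 0 <= 2 / c k * `|inner (w k.-1 - x k) (y k)|.
    by rewrite mulr_ge0// divr_ge0// ltW.
  by lra.
have dX0 : 0 <= distX k by apply: dist_ge0.
have dP0 : 0 <= distP k by apply: dist_ge0 => //; exact: pnorm_ge0.
have dXle : distX k <= kappa * (1 + q) * step_size k.
  have sq0 : 0 <= kappa * (1 + q) * step_size k.
    by rewrite mulr_ge0 ?(mulr_ge0 (ltW kappa_gt0)) ?addr_ge0.
  rewrite -ler_sqr ?nnegrE// 2!exprMn.
  have dPP := sqr_ge0 (distP k).
  (* the square of [1 + q] exceeds [1 + sigma], as [q ^+ 2 = sigma] *)
  apply: (@le_trans _ _ (kappa ^+ 2 * (1 + sigma) * step_size k ^+ 2)).
    by lra.
  by rewrite ler_wpM2r ?sqr_ge0// ler_wpM2l ?sqr_ge0// -qq; lra.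
apply: le_sqr_dist => //; first exact: pnorm_ge0.
move=> pb Pb.
have pair_bound xb : Xstar xb ->
    distP k ^+ 2 + c k ^+ 2 * step_size k ^+ 2 - pnorm (p k.-1 - pb) ^+ 2
      <= 2 * c k * q * step_size k * `|x k - xb|.
  move=> Xb; have zb : saddle (xb, pb) by rewrite XP.
  have := lagrangian_subdiff_mono _ _ _ f_proper _ _ _ _ yk zb.
  rewrite /= !subr0 pdotZl (pnorm_three_points (p k.-1) (p k) pb).
  have := @dist_le R _ pnorm (p k) pb Pstar (@pnorm_ge0 _ _ _) Pb.
  rewrite -ler_sqr ?nnegrE ?pnorm_ge0// => dPle.
  set D := pdot _ _ => mono.
  have {}mono : 0 <= c k * inner (y k) (x k - xb) + D.
    by rewrite -(pmulr_rge0 _ (_ : 0 < (c k)^-1)) ?invr_gt0// mulrDr mulKf ?gt_eqF.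
  have : inner (y k) (x k - xb) <= q * step_size k * `|x k - xb|.
    apply: le_trans (ler_norm _) _; apply: le_trans (Cauchy_Schwarz _ _) _.
    by rewrite ler_wpM2r.
  rewrite -(ler_pM2l c0).
  have -> : c k ^+ 2 * step_size k ^+ 2 = pnorm (p k.-1 - p k) ^+ 2.
    by rewrite /step_size; field; rewrite gt_eqF.
  by lra.
have K0 : 0 <= 2 * c k * q * step_size k.
  by rewrite !(mulr_ge0 _ sk0, mulr_ge0 _ q0)// mulr_ge0 ?(ltW c0).
have := le_mul_dist _ _ _ X0 _ _ K0 pair_bound.
have := ler_wpM2l K0 dXle.
rewrite -qq; lra.
Qed.

Lemma ALM_dual_contraction k : saddle !=set0 -> (1 <= k)%N ->
  2 * kappa * (sigma + Num.sqrt sigma) <= c k ->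
  distX k ^+ 2 + distP k ^+ 2 <= kappa ^+ 2 * (1 + sigma) * step_size k ^+ 2 ->
  distP k <= rate_modulus kappa sigma c k * distP k.-1.
Proof.
move=> saddle0 k1 ck bound; have [s0 s1] := andP sigma_01.
have P0 : Pstar !=set0.
  have [[xs ps]] := saddle0; rewrite saddle_solutions// => -[_ Pps].
  by exists ps.
have dP0 j : 0 <= distP j by apply: dist_ge0 => //; exact: pnorm_ge0.
apply: (le_rate_modulus _ _ _ _ _ _ (step_size k ^+ 2)) => //.
- by apply: le_trans bound; rewrite lerDr sqr_ge0.
- exact: ALM_dual_descent.
Qed.

End Method.

(** * Rates of convergence *)

Theorem theorem4p1 (R : realType) (X : fdHilbertType R) (m1 m2 : nat)
    (f : X -> \bar R) (h : X -> 'rV[R]_m1) (g : X -> 'rV[R]_m2)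
    (f_proper : proper_function f) (f_closed : closed_function f)
    (f_convex : econvex f)
    (h_affine : affine_map h)
    (g_convex : forall i : 'I_m2,
       convex_function setT (fun x : X => g x 0 i : R^o))
    (g_C1 : forall i : 'I_m2, cont_differentiable (fun x : X => g x 0 i))
    (KKT_nonempty : exists x lam mu, KKT f h g x lam mu)
    (sigma : R) (sigma_01 : 0 <= sigma < 1)
    (c : nat -> R) (c_gt0 : forall k, (1 <= k)%N -> 0 < c k)
    (c_inf : 0 < inf [set c k | k in [set k | (1 <= k)%N]])
    (x y w : nat -> X) (lam : nat -> 'rV[R]_m1) (mu : nat -> 'rV[R]_m2)
    (alm : inexact_ALM f h g sigma c x y w lam mu)
    (kappa eps : R) (kappa_gt0 : 0 < kappa) (eps_gt0 : 0 < eps)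
    (upper_Lipschitz : locally_upper_Lipschitz f h g kappa eps) :
  let Xstar := primal_solutions f h g in
  let Pstar := dual_solutions f h g in
  let p k := (lam k, mu k) in
  let distX k := dist (fun v : X => `|v|) (x k) Xstar in
  let distP k := dist pnorm (p k) Pstar in
  let rho := rate_modulus kappa sigma c in
  ((\forall k \near \oo,
      distX k <= kappa * (1 + Num.sqrt sigma) / c k * pnorm (p k.-1 - p k)) /\
   (distX k @[k --> \oo] --> (0 : R))) /\
  (((2 * kappa * (sigma + Num.sqrt sigma))%:E
      < limn_einf (fun k => (c k)%:E))%E ->
   [/\ \forall k \near \oo, distP k <= rho k * distP k.-1,
       (limn_esup (fun k => (rho k)%:E) < 1)%E,
       Q_linear distP &
       (c k @[k --> \oo] --> +oo) -> rho k @[k --> \oo] --> (0 : R)]).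
Proof.
move=> Xstar Pstar p distX distP rho.
have [s0 s1] := andP sigma_01.
have [saddle0 _] := upper_Lipschitz.
have c_below : exists2 c0 : R, 0 < c0 & forall k, (1 <= k)%N -> c0 <= c k.
  exists (inf [set c k | k in [set k | (1 <= k)%N]]) => // k k1.
  apply: ge_inf; last by exists k.
  by exists 0 => _ [j /= j1 <-]; exact/ltW/c_gt0.
have bounds := ALM_error_bound _ _ _ f_proper f_convex h_affine g_convex _ _
  sigma_01 c_gt0 _ _ _ _ _ alm _ _ kappa_gt0 eps_gt0 upper_Lipschitz c_below.
have step0 := step_size_cvg0 _ _ _ f_proper f_convex h_affine g_convex _ _
  sigma_01 c_gt0 _ _ _ _ _ alm _ _ upper_Lipschitz c_below.
have [[xs ps]] := saddle0; rewrite saddle_solutions// => -[/= Xxs Pps].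
have X0 : Xstar !=set0 by exists xs.
have P0 : Pstar !=set0 by exists ps.
have dX0 k : 0 <= distX k by apply: dist_ge0.
have dP0 k : 0 <= distP k by apply: dist_ge0 => //; exact: pnorm_ge0.
have distX_le : \forall k \near \oo,
    distX k <= kappa * (1 + Num.sqrt sigma) * step_size c lam mu k.
  near=> k; have [k1 bound] : (1 <= k)%N /\ distX k ^+ 2 + distP k ^+ 2
      <= kappa ^+ 2 * (1 + sigma) * step_size c lam mu k ^+ 2.
    by near: k; exact: bounds.
  have K0 : 0 <= kappa * (1 + Num.sqrt sigma).
    by rewrite mulr_ge0 ?addr_ge0 ?sqrtr_ge0// ltW.
  have sk0 : 0 <= step_size c lam mu k by exact: step_size_ge0.
  rewrite -ler_sqr ?nnegrE ?(mulr_ge0 K0 sk0)// 2!exprMn.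
  apply: le_trans (le_trans bound _); first by rewrite lerDl sqr_ge0.
  rewrite ler_wpM2r ?sqr_ge0// ler_wpM2l ?sqr_ge0//.
  (* [1 + sigma] is at most the square of [1 + Num.sqrt sigma] *)
  by rewrite sqrrD sqr_sqrtr// expr1n lerD2r lerDl mul1r mulrn_wge0 ?sqrtr_ge0.
split.
  split.
    by apply: filterS distX_le => k; rewrite -[X in _ -> _ <= X]mulrA [_^-1 * _]mulrC.
  apply: (@squeeze_cvgr _ _ _ _ (fun=> 0)
    (fun k => kappa * (1 + Num.sqrt sigma) * step_size c lam mu k)).
  - by apply: filterS distX_le => k ->; rewrite dX0.
  - exact: cvg_cst.
  - by rewrite -[X in _ --> X](mulr0 (kappa * (1 + Num.sqrt sigma))); exact: cvgMr.
move=> /limn_einf_gt[d d0 cd].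
(* bounds the modulus once [c] stays [d] above the threshold *)
set q := kappa * Num.sqrt (1 + sigma)
         / Num.sqrt (d ^+ 2 + kappa ^+ 2 * (1 + sigma)).
have a0 : 0 <= 2 * kappa * (sigma + Num.sqrt sigma).
  by rewrite !mulr_ge0 ?addr_ge0 ?sqrtr_ge0// ltW.
have contraction : \forall k \near \oo, distP k <= rho k * distP k.-1.
  near=> k; have [k1 bound] : (1 <= k)%N /\ distX k ^+ 2 + distP k ^+ 2
      <= kappa ^+ 2 * (1 + sigma) * step_size c lam mu k ^+ 2.
    by near: k; exact: bounds.
  have ck : 2 * kappa * (sigma + Num.sqrt sigma) <= c k.
    have : 2 * kappa * (sigma + Num.sqrt sigma) + d <= c k by near: k.
    by apply: le_trans; rewrite lerDl ltW.
  exact: (ALM_dual_contraction _ _ _ f_proper f_convex h_affine g_convex _ _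
    sigma_01 c_gt0 _ _ _ _ _ alm _ kappa_gt0 _ saddle0 k1 ck bound).
have rho_le : \forall k \near \oo, rho k <= q.
  by apply: filterS cd => k; apply: rate_modulus_le => //; exact: ltW.
have K0 : 0 < kappa ^+ 2 * (1 + sigma).
  by rewrite mulr_gt0 ?exprn_gt0// (lt_le_trans ltr01) ?lerDl.
have KE : kappa * Num.sqrt (1 + sigma) = Num.sqrt (kappa ^+ 2 * (1 + sigma)).
  by rewrite sqrtrM ?sqr_ge0// sqrtr_sqr gtr0_norm.
have q0 : 0 <= q by rewrite divr_ge0 ?sqrtr_ge0// KE sqrtr_ge0.
have q1 : q < 1.
  have dd : 0 < d ^+ 2 by rewrite exprn_gt0.
  rewrite ltr_pdivrMr ?sqrtr_gt0 ?addr_gt0// mul1r KE.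
  by rewrite ltr_sqrt ?addr_gt0// ltrDr.
split=> //.
- apply: (@le_lt_trans _ _ q%:E); last by rewrite lte_fin.
  by apply: limn_esup_le; apply: filterS rho_le => k; rewrite lee_fin.
- exists q; first by rewrite q0.
  near=> k; apply: (@le_trans _ _ (rho k * distP k.-1)); first by near: k.
  by rewrite ler_wpM2r//; near: k.
- move=> cy; apply/cvgr0Pnorm_le => e e0.
  (* at distance [d] above the threshold the modulus is at most [K / d], for [K]
     its numerator; so [K / e] suffices *)
  pose M := kappa * Num.sqrt (1 + sigma) / e.
  have M0 : 0 <= M by rewrite divr_ge0 ?(ltW e0)// KE sqrtr_ge0.
  have cM : \forall k \near \oo,
      2 * kappa * (sigma + Num.sqrt sigma) + (M + 1) <= c k.
    by move/cvgryPge : cy => /(_ (2 * kappa * (sigma + Num.sqrt sigma) + (M + 1))).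
  apply: filterS cM => k cM; rewrite ger0_norm; last first.
    by rewrite divr_ge0 ?sqrtr_ge0// KE sqrtr_ge0.
  have M10 : 0 < M + 1 by rewrite ltr_wpDl.
  apply: le_trans (rate_modulus_le _ _ (M + 1) _ _ kappa_gt0 s0 (ltW M10) cM) _.
  have : M + 1 <= Num.sqrt ((M + 1) ^+ 2 + kappa ^+ 2 * (1 + sigma)).
    rewrite -{1}(ger0_norm (ltW M10)) -sqrtr_sqr.
    rewrite ler_sqrt ?addr_ge0 ?sqr_ge0 ?(ltW K0)//.
    by rewrite lerDl ltW.
  set S := Num.sqrt (_ + _) => MS; have S0 : 0 < S by rewrite (lt_le_trans M10).
  rewrite ler_pdivrMr// [leRHS]mulrC -ler_pdivrMr// -/M.
  by apply: le_trans MS; rewrite lerDl.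
Unshelve. all: by end_near. Qed.
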